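(* Let $n\ge 1$ and let $\pi$ be a permutation of length $n$ with exactly $k$ descents. Then $\pi$ is uniquely sorted if and only if $\pi$ is sorted and $n=2k+1$.
   Context: A permutation is an ordering $\pi=\pi_1\cdots\pi_n$ of a finite set of positive integers (each element appearing once), written as a word. A descent of $\pi$ is an index $i\in\{1,\ldots,n-1\}$ with $\pi_i>\pi_{i+1}$. The (West) stack-sorting map $s$ is defined by the following procedure on an input permutation $\pi=\pi_1\cdots\pi_n$, using an initially empty vertical stack. At any point in time, if there is a next entry of the input and either it is smaller than the entry at the top of the stack or the stack is empty, then that next entry is placed on top of the stack. Otherwise, the entry at the top of the stack is removed and appended to the end of the output. The procedure terminates when the output has length $n$, and $s(\pi)$ is this output (a permutation of the same set). The fertility of $\pi$ is $|s^{-1}(\pi)|$. A permutation is sorted if its fertility is positive, and uniquely sorted if its fertility is $1$. *)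

(* Defs.v *)
From mathcomp Require Import all_boot.

Set Implicit Arguments.
Unset Strict Implicit.
Unset Printing Implicit Defensive.

(* Permutations are words of distinct positive integers; the ground set is the
   set of letters, not necessarily {1, ..., n}. *)
Definition is_permutation (w : seq nat) : bool := uniq w && all (leq 1) w.

(* 1-based indices: the i-th letter of w is nth 0 w i.-1. *)
Definition descents (w : seq nat) : seq nat :=
  [seq i <- iota 1 (size w).-1 | nth 0 w i < nth 0 w i.-1].

(* A state is (remaining input, stack, output). The head of the stack list is
   the top of the stack. *)
Definition stack_step (st : seq nat * seq nat * seq nat) :=
  match st with
  | (x :: inp, [::], out) => (inp, [:: x], out)
  | (x :: inp, t :: stk, out) =>
      if x < t then (inp, x :: t :: stk, out)
      else (x :: inp, stk, rcons out t)
  | ([::], t :: stk, out) => ([::], stk, rcons out t)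
  | ([::], [::], out) => ([::], [::], out)
  end.

(* Each letter is pushed once and popped once, so the procedure halts after
   exactly 2 * size w steps; see stack_run_halts below. *)
Definition stack_run (w : seq nat) : seq nat * seq nat * seq nat :=
  iter (2 * size w) stack_step (w, [::], [::]).

Definition stack_sort (w : seq nat) : seq nat := (stack_run w).2.

(* Since stack_sort w is a rearrangement of w, every preimage of w occurs among
   the rearrangements of w; see mem_stack_preimages below. *)
Definition stack_preimages (w : seq nat) : seq (seq nat) :=
  [seq v <- permutations w | stack_sort v == w].

Definition fertility (w : seq nat) : nat := size (stack_preimages w).

Definition stack_sorted (w : seq nat) : Prop := 0 < fertility w.

Definition uniquely_sorted (w : seq nat) : Prop := fertility w = 1.

Lemma stack_step_perm st :
  perm_eq ((stack_step st).1.1 ++ (stack_step st).1.2 ++ (stack_step st).2)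
          (st.1.1 ++ st.1.2 ++ st.2).
Proof.
case: st => [[[|x inp] [|t stk]] out] //=; last case: ifP => _ //=;
  apply/permP => a; rewrite /= -?cats1 /= !count_cat /= ?addn0 //.
- by rewrite addnA addnC.
- by rewrite addnCA.
- by rewrite addnCA.
- by rewrite (addnA (count a stk)) [_ + _ + nat_of_bool (a t)]addnC !count_cat.
Qed.

Lemma stack_step_measure st :
  (size (stack_step st).1.1).*2 + size (stack_step st).1.2
  = ((size st.1.1).*2 + size st.1.2).-1.
Proof.
case: st => [[[|x inp] [|t stk]] out] //=; last case: ifP => _ /=;
  by rewrite ?(doubleS, addSn, addnS, addn0).
Qed.

Lemma stack_run_halts w : (stack_run w).1 = ([::], [::]).
Proof.
have H m st : (size (iter m stack_step st).1.1).*2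
    + size (iter m stack_step st).1.2 = (size st.1.1).*2 + size st.1.2 - m.
  by elim: m => [|m IH]; rewrite ?subn0 // iterS stack_step_measure IH subnS.
have := H (2 * size w) (w, [::], [::]).
rewrite -/(stack_run w) /= addn0 mul2n subnn.
by case: (stack_run w) => [[[|? ?] [|? ?]] out].
Qed.

Lemma perm_stack_sort w : perm_eq (stack_sort w) w.
Proof.
have H m st : perm_eq ((iter m stack_step st).1.1 ++
    (iter m stack_step st).1.2 ++ (iter m stack_step st).2)
    (st.1.1 ++ st.1.2 ++ st.2).
  by elim: m => // m IH; apply: perm_trans IH; rewrite iterS stack_step_perm.
have := H (2 * size w) (w, [::], [::]).
by rewrite -/(stack_run w) stack_run_halts /= cats0.
Qed.

Lemma mem_stack_preimages w v : is_permutation w ->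
  v \in stack_preimages w <-> is_permutation v /\ stack_sort v = w.
Proof.
move=> w_perm; rewrite mem_filter mem_permutations; split.
  case/andP=> /eqP vw pvw; split=> //.
  by rewrite /is_permutation (perm_uniq pvw) (perm_all _ pvw).
by case=> _ vw; rewrite vw eqxx -vw perm_sym perm_stack_sort.
Qed.

Lemma uniq_stack_preimages w : uniq (stack_preimages w).
Proof. exact/filter_uniq/permutations_uniq. Qed.

(* Main.v *)
(** Writing a word with maximum [x] as [u x v], one has [s(u x v) = s(u) s(v) x],
    so the preimages of [w] are the inorder words of the decreasing binary trees
    with postorder word [w].  In a postorder word a descent can only occur where
    one passes from a left subtree to its right sibling.  Hence a word of length
    [n] with [k] descents that is the postorder word of some tree satisfies
    [2 k + 1 <= n], with equality iff the tree is tight: every node has zero or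
    two children, and each passage between siblings is a descent.

    A tight tree can be read off its postorder word, since its leaves are the
    first letter and the descent bottoms.  Conversely, a tree that is not tight
    has a partner with the same postorder word: an only child can be moved to
    the other side, and a left subtree whose root is smaller than the first leaf
    of its sibling can be hung below that leaf. *)

Require Import Defs.
From mathcomp Require Import all_boot zify.

Set Implicit Arguments.
Unset Strict Implicit.
Unset Printing Implicit Defensive.

(** * Decreasing binary trees and tightness *)

Inductive tree := Empty | Node of tree & nat & tree.

Fixpoint inorder (T : tree) : seq nat :=
  if T is Node l x r then inorder l ++ x :: inorder r else [::].

Fixpoint postorder (T : tree) : seq nat :=
  if T is Node l x r then postorder l ++ rcons (postorder r) x else [::].

Fixpoint decreasing (T : tree) : bool :=
  if T is Node l x r then
    [&& all (fun y => y < x) (postorder l), all (fun y => y < x) (postorder r),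
        decreasing l & decreasing r]
  else true.

Definition is_empty (T : tree) : bool := if T is Empty then true else false.

(** Since [Empty] is not tight, the last branch rejects every node with an only child. *)
Fixpoint tight (T : tree) : bool :=
  match T with
  | Empty => false
  | Node Empty _ Empty => true
  | Node l _ r =>
      [&& tight l, tight r & head 0 (postorder r) < last 0 (postorder l)]
  end.

Lemma inorder_Node l x r : inorder (Node l x r) = inorder l ++ x :: inorder r.
Proof. by []. Qed.

Lemma postorder_Node l x r :
  postorder (Node l x r) = postorder l ++ rcons (postorder r) x.
Proof. by []. Qed.

Lemma perm_inorder_postorder T : perm_eq (inorder T) (postorder T).
Proof.
elim: T => //= l IHl x r IHr; apply: perm_cat => //.
by rewrite perm_sym perm_rcons perm_cons perm_sym.
Qed.

Lemma size_inorder T : size (inorder T) = size (postorder T).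
Proof. exact: perm_size (perm_inorder_postorder T). Qed.

Lemma last_postorder x0 l x r : last x0 (postorder (Node l x r)) = x.
Proof. by rewrite /= last_cat last_rcons. Qed.

(** * Stack-sorting turns inorder words into postorder words *)

(** Larger letters on the stack stay put while [T] is processed. A larger next input letter, or the
    end of the input, forces every letter of [T] out. *)
Lemma stack_step_postorder T inp stk out : decreasing T ->
    all (fun t => all (fun y => y < t) (postorder T)) stk ->
    (if inp is z :: _ then all (fun y => y < z) (postorder T) else true) ->
  exists m, iter m stack_step (inorder T ++ inp, stk, out)
            = (inp, stk, out ++ postorder T).
Proof.
elim: T inp stk out => [|l IHl x r IHr] inp stk out /=.
  by exists 0; rewrite cats0.
case/and4P=> lx rx dl dr stk_gt inp_gt.
have [ml El] : exists m, iter m stack_step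
    (inorder l ++ x :: inorder r ++ inp, stk, out)
    = (x :: inorder r ++ inp, stk, out ++ postorder l).
  apply: IHl => //; apply: sub_all stk_gt => t.
  by rewrite all_cat => /andP[].
have [mr Er] : exists m, iter m stack_step
    (inorder r ++ inp, x :: stk, out ++ postorder l)
    = (inp, x :: stk, (out ++ postorder l) ++ postorder r).
  apply: IHr => //=.
    rewrite rx; apply: sub_all stk_gt => t.
    by rewrite all_cat all_rcons => /and3P[].
  by case: inp inp_gt {El} => // z inp; rewrite all_cat all_rcons => /and3P[].
(* The left subtree takes [ml] steps, pushing [x] one, the right subtree [mr], popping [x] one. *)
exists (mr + ml.+1).+1; rewrite -catA cat_cons iterS iterD iterS El.
have -> : stack_step (x :: inorder r ++ inp, stk, out ++ postorder l)
    = (inorder r ++ inp, x :: stk, out ++ postorder l).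
  case: stk stk_gt {El Er} => //= t stk /andP[].
  by rewrite all_cat all_rcons => /and3P[_ -> _] _.
rewrite Er -!cats1 !catA; case: inp inp_gt {El Er} => [|z inp] /=.
  by rewrite -cats1.
rewrite all_cat all_rcons => /and3P[_ xz _].
by rewrite ltnNge ltnW // -cats1.
Qed.

Lemma stack_sort_inorder T : decreasing T -> stack_sort (inorder T) = postorder T.
Proof.
move=> dT.
have [m] := @stack_step_postorder T [::] [::] [::] dT isT isT.
rewrite cats0 /= => Em.
have fix_done j out : iter j stack_step ([::], [::], out) = ([::], [::], out).
  by elim: j => //= j ->.
(* The runs of [m] and of [N] steps both end in halted states, which further steps fix; comparing
   each with the run of [m + N] steps identifies their outputs. *)
have := stack_run_halts (inorder T); rewrite /stack_sort /stack_run.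
set N := 2 * _; case E: (iter N _ _) => [st out] /= st0.
rewrite {}st0 in E.
have : iter (m + N) stack_step (inorder T, [::], [::]) = ([::], [::], out).
  by rewrite iterD E fix_done.
by rewrite addnC iterD Em fix_done => -[].
Qed.

(** The maximum becomes the root, and the factors on its two sides become the subtrees. *)
Lemma decreasing_tree_of v : uniq v -> exists2 T, decreasing T & inorder T = v.
Proof.
have [n] := ubnP (size v); elim: n v => // n IH v lt_vn uv.
case: (posnP (size v)) => [/size0nil -> | v_gt0]; first by exists Empty.
have [x xv max_x] : exists2 x, x \in v & {in v, forall y, y <= x}.
  elim: v v_gt0 {lt_vn uv} => // a [|b v] IHv _.
    by exists a => [|y]; rewrite inE // => /eqP ->.
  have [x xv max_x] := IHv isT.
  have [le_ax | lt_xa] := leqP a x.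
    exists x => [|y]; first by rewrite inE xv orbT.
    by rewrite inE => /predU1P[-> // | /max_x].
  exists a => [|y]; first by rewrite inE eqxx.
  by rewrite inE => /predU1P[-> // | /max_x le_yx]; lia.
case/splitPr: xv lt_vn uv max_x {v_gt0} => u1 u2.
rewrite size_cat /= cat_uniq /= negb_or => lt_n.
case/and3P=> u1u /andP[xu1 _] /andP[xu2 u2u] max_x.
have [lt1 lt2] : size u1 < n /\ size u2 < n.
  by move: (size u1) (size u2) lt_n => *; lia.
have [l dl El] : exists2 T, decreasing T & inorder T = u1 by apply: IH.
have [r dr Er] : exists2 T, decreasing T & inorder T = u2 by apply: IH.
exists (Node l x r); last by rewrite /= El Er.
rewrite /= dl dr -!(perm_all _ (perm_inorder_postorder _)) El Er !andbT.
apply/andP; split; apply/allP => y yu; rewrite ltn_neqAle max_x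
  ?mem_cat ?inE ?yu ?orbT // andbT.
  by apply: contraNneq xu1 => <-.
by apply: contraNneq xu2 => <-.
Qed.

Lemma stack_preimages_postorder w v : uniq w ->
  v \in stack_preimages w <->
  exists T, [/\ decreasing T, inorder T = v & postorder T = w].
Proof.
move=> uw; rewrite mem_filter mem_permutations; split.
  case/andP=> /eqP sv pvw.
  have [T dT ET] : exists2 T, decreasing T & inorder T = v.
    by apply: decreasing_tree_of; rewrite (perm_uniq pvw).
  by exists T; rewrite -stack_sort_inorder // ET.
case=> T [dT <- <-].
by rewrite stack_sort_inorder // eqxx perm_inorder_postorder.
Qed.

(** * Descents of postorder words *)

Lemma size_descents_cons2 x y s :
  size (descents [:: x, y & s]) = (y < x) + size (descents (y :: s)).
Proof.
rewrite /descents !size_filter /= -[iota 2 _]/(iota (1 + 1) _) iotaDl count_map.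
(* Index 0, where the truncated predecessor would break the shift, is outside the range. *)
by congr (_ + _); apply/eq_in_count => -[|i]; rewrite mem_iota.
Qed.

Lemma size_descents_cat x s y t :
  size (descents (x :: s ++ y :: t))
  = size (descents (x :: s)) + (y < last x s) + size (descents (y :: t)).
Proof.
elim: s x => [|z s IH] x /=; first by rewrite size_descents_cons2.
by rewrite !size_descents_cons2 IH !addnA.
Qed.

Lemma size_descents_rcons s x : all (fun y => y < x) s ->
  size (descents (rcons s x)) = size (descents s).
Proof.
case: s => // a s lt_x; rewrite -cats1 /= size_descents_cat /= addn0.
by rewrite ltnNge ltnW ?addn0 // (allP lt_x) // mem_last.
Qed.

(** The root, being the maximum, adds a letter but no descent, so an only child makes the bound
    strict. With two children, the two bounds add up and leave room for exactly one descent between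
    the siblings. *)
Lemma descents_postorder_leqif T : decreasing T -> ~~ is_empty T ->
  2 * size (descents (postorder T)) + 1 <= size (postorder T) ?= iff tight T.
Proof.
elim: T => // l IHl x r IHr /= /and4P[lx rx dl dr] _.
rewrite -rcons_cat size_descents_rcons ?all_cat ?lx // size_rcons size_cat.
case: l r IHl IHr dl dr {lx rx} => [|l1 a l2] [|r1 b r2] IHl IHr dl dr //.
- have [] := IHr dr isT => le_r _.
  by split; rewrite /= in le_r *; lia.
- have [] := IHl dl isT => le_l _.
  by split; rewrite /= ?andbF ?cats0 in le_l *; lia.
have [le_l eq_l] := IHl dl isT; have [le_r eq_r] := IHr dr isT.
rewrite -{}eq_l -{}eq_r; move: (postorder _) (postorder _) le_l le_r.
move=> [|c s] [|d t] //= le_l le_r; try lia.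
by rewrite size_descents_cat; split; [|case: ltnP]; lia.
Qed.

(** * Reading a tight tree off its postorder word *)

(* [p] is the letter read last, and [stk] holds the trees waiting for a parent. *)
Fixpoint parse (stk : seq tree) (p : nat) (w : seq nat) : seq tree :=
  if w is c :: w' then
    if p < c then
      if stk is r :: l :: stk' then parse (Node l c r :: stk') c w' else [::]
    else parse (Node Empty c Empty :: stk) c w'
  else stk.

(** An inner node of a tight tree follows the smaller root of its right subtree, whereas a leaf
    other than the first is a descent bottom. The bound on [p] makes the first letter be read as a
    leaf too. *)
Lemma parse_postorder T stk p w : decreasing T -> tight T ->
    head 0 (postorder T) <= p ->
  parse stk p (postorder T ++ w) = parse (T :: stk) (last 0 (postorder T)) w.
Proof.
elim: T stk p w => // l IHl x r IHr stk p w.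
rewrite last_postorder [decreasing _]/= => /and4P[_ rx dl dr].
case: l r IHl IHr rx dl dr => [|l1 a l2] [|r1 b r2] IHl IHr rx dl dr;
  try by rewrite /= ?andbF.
  by rewrite /= leqNgt; case: (p < x).
case/and3P=> tl tr lt_rl le_p.
rewrite postorder_Node -catA cat_rcons IHl //; last first.
  by move: le_p => /=; case: (postorder l1) => //=; case: (postorder l2).
rewrite IHr ?(ltnW lt_rl) // last_postorder /=.
by rewrite (allP rx) // /= mem_cat mem_rcons mem_head orbT.
Qed.

Lemma tight_postorder_inj T1 T2 :
    decreasing T1 -> tight T1 -> decreasing T2 -> tight T2 ->
  postorder T1 = postorder T2 -> T1 = T2.
Proof.
move=> d1 t1 d2 t2 E; pose p := head 0 (postorder T1).
have := @parse_postorder T1 [::] p [::] d1 t1 (leqnn _).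
have := @parse_postorder T2 [::] p [::] d2 t2.
by rewrite /p E leqnn => /(_ isT) -> [].
Qed.

(** * Partners of trees that are not tight *)

(** [l] replaces the leftmost empty subtree; in a tight tree this is the left child of the first
    leaf. *)
Fixpoint graft (l T : tree) : tree :=
  if T is Node T1 y T2 then Node (graft l T1) y T2 else l.

Lemma postorder_graft l T : postorder (graft l T) = postorder l ++ postorder T.
Proof. by elim: T => [|T1 IH x T2 _] /=; rewrite ?cats0 // IH catA. Qed.

(** The new ancestors of [l] form the leftmost path of [T]. By tightness it ends at the head of the
    postorder word, its smallest letter, which already exceeds all of [l]. *)
Lemma decreasing_graft l T : decreasing l -> decreasing T -> tight T ->
    all (fun y => y < head 0 (postorder T)) (postorder l) ->
  decreasing (graft l T).
Proof.
move=> dl; elim: T => // T1 IH x T2 _ dT tT lt_l.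
have le_x : head 0 (postorder (Node T1 x T2)) <= x.
  move: dT => /=; case: (postorder T1) => [|c s] /=.
    by case: (postorder T2) => //= c s /and3P[/andP[/ltnW]].
  by case/andP=> /andP[/ltnW].
have lt_lx : all (fun y => y < x) (postorder l).
  by apply: sub_all lt_l => y lt_y; apply: leq_trans lt_y le_x.
case/and4P: dT => T1x T2x d1 d2.
suff dg : decreasing (graft l T1).
  by apply/and4P; split; rewrite // postorder_graft all_cat lt_lx.
case: T1 {le_x T1x} IH d1 tT lt_l => // l1 a l2 IH d1 tT lt_l.
apply: IH => //; first by case: T2 tT {T2x d2 lt_l} => [|? ? ?] /and3P[].
by move: lt_l => /=; case: (postorder l1) => //=; case: (postorder l2).
Qed.

Lemma not_tight_partner T :
    decreasing T -> uniq (postorder T) -> ~~ is_empty T -> ~~ tight T ->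
  exists T', [/\ decreasing T', postorder T' = postorder T
               & inorder T' <> inorder T].
Proof.
(* Whenever a subtree is moved across or below, one of the two inorder words starts with the root
   [x] and the other with a smaller letter. *)
have head_neq x l1 a l2 s t : all (fun y => y < x) (postorder (Node l1 a l2)) ->
    x :: s <> inorder (Node l1 a l2) ++ t.
  rewrite -(perm_all _ (perm_inorder_postorder _)).
  case E: (inorder _) => [|c u].
    by have := size_inorder (Node l1 a l2); rewrite E /= size_cat size_rcons; lia.
  by move=> /= /andP[lt_cx _] [eq_xc]; rewrite eq_xc ltnn in lt_cx.
elim: T => // l IHl x r IHr; rewrite [decreasing _]/= => /and4P[lx rx dl dr].
rewrite [postorder _]/= cat_uniq rcons_uniq => /and4P[ul disj _ ur] _.
case: l r IHl IHr lx rx dl dr ul ur disj =>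
  [|l1 a l2] [|r1 b r2] IHl IHr lx rx dl dr ul ur disj //.
- move=> _; exists (Node (Node r1 b r2) x Empty).
  split; first by apply/and4P.
    by rewrite !(postorder_Node _ x) cats1.
  by move/esym; apply: head_neq.
- move=> _; exists (Node Empty x (Node l1 a l2)).
  split; first by apply/and4P.
    by rewrite !(postorder_Node _ x) cats1.
  exact: head_neq.
set l := Node l1 a l2 in IHl lx dl ul disj *.
set r := Node r1 b r2 in IHr rx dr ur disj *.
rewrite -[tight _]/[&& tight l, tight r
  & head 0 (postorder r) < last 0 (postorder l)].
have [tl | ntl _] := boolP (tight l); last first.
  (* A defect inside a subtree is handled by putting that subtree's partner in its place. *)
  have [l' [dl' El' neq]] := IHl dl ul isT ntl.
  exists (Node l' x r); split.
  - by apply/and4P; rewrite El'.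
  - by rewrite !(postorder_Node _ x) El'.
  move/eqP; rewrite !(inorder_Node _ x) eqseq_cat; last by rewrite !size_inorder El'.
  by case/andP=> /eqP.
have [tr | ntr _] := boolP (tight r); last first.
  have [r' [dr' Er' neq]] := IHr dr ur isT ntr.
  exists (Node l x r'); split.
  - by apply/and4P; rewrite Er'.
  - by rewrite !(postorder_Node _ x) Er'.
  by move/eqP; rewrite !(inorder_Node _ x) eqseq_cat // => /andP[_ /eqP[]].
(* Both subtrees are tight, so the defect is the passage between them. As letters are distinct, the
   root [a] of [l] is strictly below the first leaf of [r], and hence so is all of [l]. *)
rewrite !andTb -leqNgt last_postorder => le_ar.
have head_r : head 0 (postorder r) \in postorder r.
  by rewrite /r /=; case: (postorder r1) => [|c s]; [case: (postorder r2) => [|c s]|];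
    apply: mem_head.
have lt_ar : a < head 0 (postorder r).
  rewrite ltn_neqAle le_ar andbT; apply: contra disj => /eqP a_head.
  apply/hasP; exists a; first by rewrite mem_rcons inE a_head head_r orbT.
  by rewrite /= mem_cat mem_rcons mem_head orbT.
have lt_l : all (fun y => y < head 0 (postorder r)) (postorder l).
  case/and4P: dl => l1a l2a _ _.
  rewrite postorder_Node all_cat all_rcons lt_ar /=.
  by apply/andP; split; [apply: sub_all l1a|apply: sub_all l2a] => y lt_ya;
    apply: ltn_trans lt_ar.
have dg : decreasing (graft l r) by apply: decreasing_graft.
exists (Node Empty x (graft l r)); split.
- have gx : all (fun y => y < x) (postorder (graft l r)).
    by rewrite postorder_graft all_cat lx.
  by apply/and4P.
- by rewrite (postorder_Node _ x) postorder_graft rcons_cat.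
exact: head_neq.
Qed.

(** * Unique sortedness and tightness *)

Theorem proposition3p3 (n k : nat) (w : seq nat) (n_ge1 : 1 <= n)
    (w_perm : is_permutation w) (w_size : size w = n)
    (w_des : size (descents w) = k) :
  uniquely_sorted w <-> (stack_sorted w /\ n = 2 * k + 1).
Proof.
have uw : uniq w by case/andP: w_perm.
have nonempty T : postorder T = w -> ~~ is_empty T.
  by case: T => // Ew; rewrite -w_size -Ew in n_ge1.
rewrite -{}w_size -{}w_des /stack_sorted /uniquely_sorted /fertility.
split=> [fert1 | [sorted_w size_w]].
  split; first by rewrite fert1.
  case E: (stack_preimages w) fert1 => [|v [|]] // _.
  have /(stack_preimages_postorder _ uw)[T [dT ET PT]] : v \in stack_preimages w.
    by rewrite E mem_head.
  apply/esym/eqP; rewrite -{1 2}PT.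
  have [_ ->] := descents_postorder_leqif dT (nonempty T PT).
  (* The partner of a non-tight tree would yield a second preimage. *)
  apply/negPn/negP => ntT.
  have uT : uniq (postorder T) by rewrite PT.
  have [T' [dT' PT' neq]] := not_tight_partner dT uT (nonempty T PT) ntT.
  have : inorder T' \in stack_preimages w.
    by apply/stack_preimages_postorder => //; exists T'; rewrite PT' PT.
  by rewrite E inE -ET => /eqP.
(* Equality in the descent bound makes every tree of [w] tight, so any two preimages come from the
   same tree. *)
have tightP T : decreasing T -> postorder T = w -> tight T.
  move=> dT PT; have [_ <-] := descents_postorder_leqif dT (nonempty T PT).
  by rewrite PT size_w.
case E: (stack_preimages w) sorted_w => [|v1 [|v2 vs]] // _.
have /(stack_preimages_postorder _ uw)[T1 [d1 E1 P1]] : v1 \in stack_preimages w.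
  by rewrite E mem_head.
have /(stack_preimages_postorder _ uw)[T2 [d2 E2 P2]] : v2 \in stack_preimages w.
  by rewrite E !inE eqxx orbT.
have ET : T1 = T2 by apply: tight_postorder_inj; rewrite ?tightP // P1.
have := uniq_stack_preimages w.
by rewrite E -E1 -E2 ET /= inE eqxx.
Qed.
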